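(* Let $G$ and $H$ be graphs on at least two vertices each such that the Cartesian product $G\Box H$ is connected. Let $Y$ be a proper subset of $V(G\Box H)$ which does not induce a complete graph in $G\Box H$. Then $Y$ is t-convex in $G\Box H$ if and only if, up to interchanging the roles of the two factors $G$ and $H$, the following holds: $H$ is a complete graph and $Y=V(G_1)\times V(H)$, where $G_1$ is an induced subgraph of $G$ that is a path $P=v_1,\ldots,v_k$ (i.e. $P$ is an induced path in $G$), every inner vertex of $P$ has degree $2$ in $G$, and $P$ is the only $v_1,v_k$-path in $G$.
   Context: All graphs are finite, undirected, without loops or multiple edges. The Cartesian product $G\Box H$ has vertex set $V(G)\times V(H)$, and $(g_1,h_1)$, $(g_2,h_2)$ are adjacent when ($g_1g_2\in E(G)$ and $h_1=h_2$) or ($g_1=g_2$ and $h_1h_2\in E(H)$). A set of vertices induces a complete graph if any two distinct vertices in it are adjacent. For distinct non-adjacent vertices $u,v$ of a graph $F$, a tolled walk between $u$ and $v$ is a sequence of vertices $u,w_1,\ldots,w_k,v$ with $k\ge 1$ such that $w_iw_{i+1}\in E(F)$ for all $1\le i<k$, $uw_i\in E(F)$ if and only if $i=1$, and $vw_i\in E(F)$ if and only if $i=k$. If $uv\in E(F)$, the only tolled walk between $u$ and $v$ is $u,v$; the only tolled walk from $v$ to $v$ is $v$ itself. The toll interval $T_F(u,v)$ is the set of all vertices lying on some tolled walk between $u$ and $v$. A set $S\subseteq V(F)$ is t-convex if $T_F(u,v)\subseteq S$ for all $u,v\in S$. *)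

(* Defs.v *)
From mathcomp Require Import all_boot.

Set Implicit Arguments.
Unset Strict Implicit.
Unset Printing Implicit Defensive.

Record sgraph := SGraph {
  svertex :> finType;
  sedge : rel svertex;
  sedge_sym : symmetric sedge;
  sedge_irrefl : irreflexive sedge }.

Notation "x -- y" := (sedge x y) (at level 30, no associativity).

Section CartesianProduct.
Variables G H : sgraph.

Definition cart_rel : rel (G * H) :=
  fun x y => ((x.1 -- y.1) && (x.2 == y.2)) || ((x.1 == y.1) && (x.2 -- y.2)).

Lemma cart_sym : symmetric cart_rel.
Proof.
by move=> x y; rewrite /cart_rel (sedge_sym x.1) (sedge_sym x.2)
  (eq_sym x.1) (eq_sym x.2).
Qed.

Lemma cart_irrefl : irreflexive cart_rel.
Proof. by move=> x; rewrite /cart_rel !sedge_irrefl andbF. Qed.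

Definition cart : sgraph := SGraph cart_sym cart_irrefl.

End CartesianProduct.

Section GraphNotions.
Variable F : sgraph.
Implicit Types (u v x y : F) (S : {set F}) (p q w : seq F).

Definition connected : Prop := forall x y, connect (@sedge F) x y.

Definition induces_complete S : Prop :=
  forall x y, x \in S -> y \in S -> x != y -> x -- y.

Definition degree x : nat := #|[set y | x -- y]|.

Definition tolled_walk u v p : Prop :=
  if u == v then p = [:: v]
  else if u -- v then p = [:: u; v]
  else exists w,
    [/\ p = u :: rcons w v,
        0 < size w,
        sorted (@sedge F) w,
        forall i, i < size w -> (u -- nth u w i) = (i == 0)
      & forall i, i < size w -> (v -- nth v w i) = (i == (size w).-1)].

Definition toll_interval u v x : Prop := exists2 p, tolled_walk u v p & x \in p.

Definition t_convex S : Prop :=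
  forall u v, u \in S -> v \in S -> forall x, toll_interval u v x -> x \in S.

(* As in the MathComp library, a path with at least one vertex is given by its
   first vertex x and the sequence p of the remaining ones: the path v_1..v_k
   is x :: p with x = v_1, last x p = v_k and k = (size p).+1. *)
Definition graph_path x p : Prop := path (@sedge F) x p /\ uniq (x :: p).

Definition induced_path x p : Prop :=
  graph_path x p /\
  forall i j, i < size (x :: p) -> j < size (x :: p) ->
    (nth x (x :: p) i -- nth x (x :: p) j) = (j == i.+1) || (i == j.+1).

Definition inner_degree2 x p : Prop :=
  forall i, 0 < i < size p -> degree (nth x (x :: p) i) = 2.

Definition only_path x p : Prop :=
  forall q, graph_path x q -> last x q = last x p -> q = p.

End GraphNotions.

Definition complete (H : sgraph) : Prop := induces_complete [set: H].

(* Main.v *)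
Require Import Defs.
From mathcomp Require Import all_boot zify.

Set Implicit Arguments.
Unset Strict Implicit.
Unset Printing Implicit Defensive.

(** Why the theorem holds.

    A vertex [x] other than [u] and [v] lies on a tolled walk between the
    distinct non-adjacent vertices [u] and [v] exactly when [x] has a walk to
    [v] that, once it has left [x], stays out of the closed neighbourhood of
    [u], and a walk to [u] with [u] and [v] exchanged: cut both walks at the
    first neighbours that they meet and glue them at [x]
    ([toll_interval_off], [tolled_walk_off]). All arguments below are about
    such screened walks, that is, about reachability in [off Z].

    Let [Y] be t-convex in the product. Walking along a row or a column shows
    that [Y] contains the two missing corners of each rectangle that it meets
    in opposite corners, so [Y] is a product [A * B] ([t_convex_prod]). Two
    non-adjacent vertices in a row make [Y] grow along columns, so [B] is
    everything as soon as [A] is not complete, and vice versa ([rect_complete]).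
    As [Y] is proper, one factor, say [A], is not everything; then [B] is
    complete, and as [Y] does not induce a complete graph both [A] and [B] have
    at least two elements. An edge in [B] lets a walk leave the row of [(a, h)], after
    which only the vertices in column [a] itself are forbidden. So [A] is
    separation-closed: if [g] reaches [a1] without [a2] and [a2] without [a1],
    where [a1] and [a2] are distinct elements of [A], then [g] is in [A]
    ([rect_separation]). If [B] were not everything either, then both [A]
    and [B] would be separation-closed and complete, and a tolled walk around an outer
    corner would contradict convexity ([t_convex_outer_corner]). Hence [B] is
    everything, and the second factor is complete.

    The rest is about one graph. Let [A] be separation-closed and let [c] in
    [A] have a neighbour outside. Seen from that neighbour, of any two further
    elements of [A] one separates the other from [c]. An element [e] with as
    many vertices as possible in front of it is separated from [c] by all the
    others, so each path from [c] to [e] visits all of [A], and nothing else.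
    That makes the path unique and chordless, with inner vertices of degree 2
    ([separation_closed_path]). Conversely such a path is separation-closed
    ([path_separation_closed]), and its product with a complete graph is
    t-convex, because a whole layer lies in the closed neighbourhood of each
    of its vertices ([separation_closed_t_convex]). *)

(** * Walks avoiding a set of vertices *)

Lemma connect_invariant (T : finType) (e : rel T) (X : pred T) x y :
  (forall a b, X a -> e a b -> X b) -> connect e x y -> X x -> X y.
Proof.
move=> stepX /connectP[p e_p ->]; elim: p x e_p => //= a p IHp x /andP[xa ap] Xx.
exact: IHp ap (stepX _ _ Xx xa).
Qed.

Lemma connect_homo (T T' : finType) (e : rel T) (e' : rel T') (f : T -> T') x y :
  (forall a b, e a b -> connect e' (f a) (f b)) ->
  connect e x y -> connect e' (f x) (f y).
Proof.
move=> f_hom exy.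
apply: (connect_invariant (X := fun z => connect e' (f x) (f z))) exy _ => //.
by move=> a b xa /f_hom; apply: connect_trans.
Qed.

(** Only the head of an edge has to avoid [Z], so a walk may start in [Z]; this
    is what lets the glueing vertex of a tolled walk be a neighbour of an end. *)
Definition off (F : sgraph) (Z : pred F) : rel F :=
  [rel x y | (x -- y) && ~~ Z y].

Definition closed_nbhd (F : sgraph) (u : F) : pred F :=
  [pred y | (y == u) || (u -- y)].

Section Avoiding.
Variable F : sgraph.
Implicit Types (Z : pred F) (x y a c e : F) (p : seq F).

Lemma off_edge Z x y : x -- y -> ~~ Z y -> connect (off Z) x y.
Proof. by move=> xy Zy; apply: connect1; apply/andP. Qed.

Lemma off_path Z x p : path (off Z) x p = path (@sedge F) x p && all (predC Z) p.
Proof.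
elim: p x => //= y p IHp x; rewrite IHp /off /= -!andbA; congr (_ && _).
by rewrite andbCA.
Qed.

Lemma connect_off Z x p :
  path (@sedge F) x p -> all (predC Z) p -> connect (off Z) x (last x p).
Proof. by move=> xp Zp; apply/connectP; exists p; rewrite // off_path xp. Qed.

Lemma off_neq Z x y : connect (off Z) x y -> ~~ Z x -> ~~ Z y.
Proof. by move=> xy; apply: (connect_invariant (X := predC Z)) xy => a b _ /andP[]. Qed.

Lemma off_sym Z x y : ~~ Z x -> connect (off Z) x y -> connect (off Z) y x.
Proof.
move=> Zx xy; have /andP[] // : connect (off Z) y x && ~~ Z y.
apply: (connect_invariant (X := fun z => connect (off Z) z x && ~~ Z z)) xy _.
  move=> a b /andP[ax Za] /andP[ab Zb]; rewrite Zb andbT.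
  by apply: connect_trans ax; apply: off_edge; rewrite 1?sedge_sym.
by rewrite connect0.
Qed.

Lemma off_simple Z x y : connect (off Z) x y ->
  exists p, [/\ graph_path x p, all (predC Z) p & last x p = y].
Proof.
case/connectP=> p xp ->; case/shortenP: xp => q xq uq _.
by move: xq; rewrite off_path => /andP[xq Zq]; exists q.
Qed.

Lemma connected_simple x y : connected F -> exists2 p, graph_path x p & last x p = y.
Proof.
move=> conF; have [|p [xp _ pE]] := @off_simple pred0 x y; last by exists p.
by apply: connect_sub (conF x y) => a b ab; apply: off_edge.
Qed.

(** If [a] screens [e] off from [c], then whatever [c] still reaches without
    [a] it reaches along a walk on which [e] never occurs. *)
Lemma off_screened a c e x : ~~ connect (off (pred1 a)) c e ->
  connect (off (pred1 a)) c x -> connect (off (pred1 e)) c x.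
Proof.
move=> Nce cx.
suff /andP[]: connect (off (pred1 a)) c x && connect (off (pred1 e)) c x by [].
pose X z := connect (off (pred1 a)) c z && connect (off (pred1 e)) c z.
apply: (connect_invariant (X := X)) cx _; last by rewrite /X !connect0.
rewrite /X => y z /andP[ay ey] yz.
have az : connect (off (pred1 a)) c z by apply: connect_trans ay (connect1 yz).
rewrite az /=; apply: connect_trans ey _; apply: off_edge; first by case/andP: yz.
by apply: contraNN Nce => /eqP <-.
Qed.

Lemma simple_tail c p y :
  graph_path c p -> y \in c :: p -> connect (off (pred1 c)) y (last c p).
Proof.
case=> cp /andP[/= Ncp _]; rewrite inE => /predU1P[-> | py].
  by apply: connect_off cp _; apply/allP => z pz; apply: contraNneq Ncp => <-.
case/splitPr: py cp Ncp => p1 p2; rewrite cat_path last_cat /= => /and3P[_ _ yp].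
rewrite mem_cat !inE !negb_or => /and3P[_ _ Ncp2]; apply: connect_off yp _.
by apply/allP => z pz; apply: contraNneq Ncp2 => <-.
Qed.

Lemma simple_head c p y : graph_path c p -> y \in c :: p -> y != last c p ->
  connect (off (pred1 (last c p))) c y.
Proof.
case=> cp; rewrite inE => up /predU1P[-> | py]; first by rewrite connect0.
case/splitPr: py cp up => p1 p2; rewrite cat_path last_cat /= -/(rcons _ _).
move=> /and3P[cp1 p1y _] up yl.
rewrite -[y](last_rcons c p1); apply: connect_off.
  by rewrite rcons_path cp1.
apply/allP=> z; rewrite mem_rcons => p1z /=; apply: contraNneq yl => zl.
have: ~~ has (mem (rcons p1 y)) p2.
  by move: up; rewrite -cat_rcons cat_uniq => /and4P[].
case: (lastP p2) zl => [|s t] //=; rewrite last_rcons => <-.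
rewrite has_rcons negb_or /= => /andP[].
by rewrite mem_rcons p1z.
Qed.

End Avoiding.

(** * Tolled walks as pairs of screened walks *)

Section TollIntervals.
Variable F : sgraph.
Implicit Types (u v x y : F) (p s w : seq F) (S : {set F}).

Lemma tolled_walk_rev u v p : tolled_walk u v p -> tolled_walk v u (rev p).
Proof.
rewrite /tolled_walk eq_sym (sedge_sym v u).
case: eqVneq => [-> -> // | _]; case: ifP => [_ -> // | _].
case=> w [-> w0 sw uw vw]; exists (rev w); rewrite size_rev; split=> //.
- by rewrite rev_cons rev_rcons.
- by rewrite rev_sorted; apply: sub_sorted sw => x y; rewrite sedge_sym.
- by move=> i iw; rewrite nth_rev // ?vw; lia.
- by move=> i iw; rewrite nth_rev // ?uw; lia.
Qed.

(** On the remainder of a tolled walk from [u] no vertex is adjacent to [u];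
    then [u] itself does not recur either, as its successor would be adjacent. *)
Lemma path_off_closed_nbhd u x s : path (@sedge F) x s ->
  all (fun y => ~~ (u -- y)) s -> last x s != u ->
  all (predC (closed_nbhd u)) s.
Proof.
elim: s x => //= y s IHs x /andP[_ ys] /andP[uy us] lu.
rewrite (IHs y) // /closed_nbhd /= negb_or uy !andbT.
case: s ys us lu {IHs} => //= z s /andP[yz _] /andP[uz _] _.
by apply: contraNneq uz => <-.
Qed.

Lemma tolled_walk_off u v p x : u != v -> ~~ (u -- v) -> tolled_walk u v p ->
  x \in p -> x != u -> x != v -> connect (off (closed_nbhd u)) x v.
Proof.
move=> uv Nuv; rewrite /tolled_walk (negPf uv) (negPf Nuv).
case=> w [-> _ sw uw vw]; rewrite inE mem_rcons inE => /or3P[/eqP->|/eqP->|].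
- by rewrite eqxx.
- by rewrite eqxx.
move=> xw _ _; case/splitPr: xw sw uw vw => w1 w2 sw uw vw.
have xw2 : path (@sedge F) x w2 by move: sw; rewrite sorted_cat_cons => /andP[].
have vl : v -- last x w2.
  have := vw (size w1 + size w2); rewrite size_cat /= addnS ltnSn eqxx.
  by rewrite nth_cat ltnNge leq_addr /= addKn -last_nth => ->.
have uw2 : all (fun y => ~~ (u -- y)) w2.
  apply/(all_nthP u) => i iw2; have := uw (size w1 + i.+1).
  rewrite size_cat /= ltn_add2l ltnS iw2 nth_cat ltnNge leq_addr /= addKn /=.
  by move=> ->; rewrite // addnS.
have <- : last x (rcons w2 v) = v by rewrite last_rcons.
apply: connect_off; first by rewrite rcons_path xw2 sedge_sym.
apply: (@path_off_closed_nbhd _ x); rewrite ?last_rcons 1?eq_sym //.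
  by rewrite rcons_path xw2 sedge_sym.
by rewrite all_rcons Nuv.
Qed.

(** The walk [s] is the given one, cut at its first neighbour of [u]. *)
Lemma first_leg u v x : connect (off (closed_nbhd v)) x u -> x != u ->
  exists s, [/\ path (@sedge F) x s, all (fun y => ~~ (v -- y)) s,
    u -- last x s & all (fun y => ~~ (u -- y)) (belast x s)].
Proof.
case/connectP=> p; elim: p x => [|y p IHp] x /=; first by move=> _ -> /eqP.
move=> /andP[/andP[xy Nvy] yp] lp xu.
case: (boolP (u -- x)) => [ux | Nux]; first by exists [::].
have yu : y != u by apply: contraNneq Nux => <-; rewrite sedge_sym.
have [s [ys vs us Nus]] := IHp y yp lp yu.
exists (y :: s); split=> //=; rewrite ?xy ?vs ?Nux ?andbT //.
by move: Nvy; rewrite negb_or => /andP[].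
Qed.

(** Walks from [x] to [u] and to [v], cut at the first neighbours of [u] and
    [v] that they meet, fit together to a tolled walk. *)
Lemma toll_interval_off u v x : u != v -> ~~ (u -- v) ->
  connect (off (closed_nbhd v)) x u -> connect (off (closed_nbhd u)) x v ->
  x != u -> x != v -> toll_interval u v x.
Proof.
move=> uv Nuv xu xv xNu xNv.
have [s [xs vs us Nus]] := first_leg xu xNu.
have [t [xt ut vt Nvt]] := first_leg xv xNv.
pose w := rev (x :: s) ++ t.
have wl : w = last x s :: rev (belast x s) ++ t by rewrite /w lastI rev_rcons.
have wr : w = rcons (rev s ++ belast x t) (last x t).
  by rewrite rcons_cat -lastI /w rev_cons cat_rcons.
exists (u :: rcons w v); last first.
  by rewrite inE mem_rcons inE mem_cat mem_rev inE eqxx !orbT.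
rewrite /tolled_walk (negPf uv) (negPf Nuv); exists w; split=> //.
- by rewrite wl.
- rewrite wl /= cat_path rev_path (eq_path (e' := @sedge F)) => [|a b]; last first.
    by rewrite sedge_sym.
  by rewrite xs /=; case: (s) => //= y s'; rewrite rev_cons last_rcons.
- have Nu : all (fun y => ~~ (u -- y)) (rev (belast x s) ++ t) by rewrite all_cat all_rev Nus.
  by rewrite wl => -[|i] //= iw; apply/negbTE/(all_nthP u Nu).
- have Nv : all (fun y => ~~ (v -- y)) (rev s ++ belast x t) by rewrite all_cat all_rev vs.
  rewrite wr size_rcons /= => i iw; rewrite nth_rcons.
  case: ltngtP => [il|il|_] //; last by rewrite ltnNge il in iw.
  exact/negbTE/(all_nthP v Nv).
Qed.

End TollIntervals.

Lemma t_convex_off (F : sgraph) (S : {set F}) u v x : t_convex S ->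
  u \in S -> v \in S -> u != v -> ~~ (u -- v) ->
  connect (off (closed_nbhd v)) x u -> connect (off (closed_nbhd u)) x v ->
  x \in S.
Proof.
move=> convS Su Sv uv Nuv xu xv.
have [-> //|xNu] := eqVneq x u; have [-> //|xNv] := eqVneq x v.
exact: convS Su Sv _ (toll_interval_off uv Nuv xu xv xNu xNv).
Qed.

Lemma t_convexP_off (F : sgraph) (S : {set F}) :
  (forall u v x, u \in S -> v \in S -> u != v -> ~~ (u -- v) ->
     x != u -> x != v ->
     connect (off (closed_nbhd v)) x u -> connect (off (closed_nbhd u)) x v ->
     x \in S) -> t_convex S.
Proof.
move=> clS u v Su Sv x [p tp px].
have [uv | uv] := eqVneq u v.
  by move: tp px; rewrite /tolled_walk uv eqxx => ->; rewrite inE => /eqP->.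
have [Euv | Nuv] := boolP (u -- v).
  move: tp px; rewrite /tolled_walk (negPf uv) Euv => ->.
  by rewrite !inE => /orP[] /eqP->.
have [-> //|xNu] := eqVneq x u; have [-> //|xNv] := eqVneq x v.
have := tolled_walk_off (x := x) _ _ (tolled_walk_rev tp).
rewrite mem_rev px eq_sym uv sedge_sym Nuv => /(_ isT isT isT xNv xNu) xu.
exact: clS Su Sv uv Nuv xNu xNv xu (tolled_walk_off uv Nuv tp px xNu xNv).
Qed.

(** An embedding as induced subgraph carries tolled walks to tolled walks; the
    exchange of the two factors of a product is an instance. *)
Lemma t_convex_preim (F F' : sgraph) (f : F -> F') (S : {set F'}) :
  injective f -> (forall x y, (f x -- f y) = (x -- y)) ->
  t_convex S -> t_convex (f @^-1: S).
Proof.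
move=> injf fE convS u v; rewrite !inE => Su Sv x [p tp px]; rewrite inE.
apply: (convS _ _ Su Sv); exists (map f p); last exact: map_f.
move: tp; rewrite /tolled_walk (inj_eq injf) fE.
case: eqP => [_ -> //|_]; case: ifP => [_ -> //|_].
case=> w [-> w0 sw uw vw]; exists (map f w); rewrite size_map; split=> //.
- by rewrite /= map_rcons.
- by rewrite sorted_map; apply: sub_sorted sw => a b; rewrite /= fE.
- by move=> i iw; rewrite (nth_map u) // fE uw.
- by move=> i iw; rewrite (nth_map v) // fE vw.
Qed.

(** * Paths forced to visit a fixed set *)

Lemma last_take (T : Type) (x : T) s i :
  i <= size s -> last x (take i s) = nth x (x :: s) i.
Proof.
case: i => [|i] le_i; first by rewrite take0.
by rewrite -nth_last size_takel //= nth_take ?(set_nth_default x).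
Qed.

(** Here each path from [c] to [e] runs through all of [A] and nothing else, so
    that all these paths have the same length. *)
Section ForcedPaths.
Variables (F : sgraph) (c e : F) (A : {set F}).
Hypothesis (covers : forall q, graph_path c q -> last c q = e -> c :: q =i A).

Lemma forced_size p q : graph_path c p -> last c p = e ->
  graph_path c q -> last c q = e -> size p = size q.
Proof.
move=> cp lp cq lq; suff: size (c :: p) = size (c :: q) by case.
apply: perm_size; apply: uniq_perm; [by case: cp | by case: cq |].
by move=> x; rewrite !covers.
Qed.

(** A chord would give a shorter path from [c] to [e]. *)
Lemma forced_induced p : graph_path c p -> last c p = e -> induced_path c p.
Proof.
move=> cp lp; split=> // i j.
wlog lt_ij : i j / i < j => [Wlog ip jp|].
  have [ij|ij|->] := ltngtP i j; first exact: Wlog.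
    by rewrite sedge_sym orbC; apply: Wlog.
  by rewrite sedge_irrefl; lia.
rewrite /= !ltnS => _ jp; have [pp up] := cp.
have -> : (i == j.+1) = false by lia.
rewrite orbF; apply/idP/eqP => [chord | ->]; last by apply: (pathP c pp); lia.
have defp : p = take j.-1 p ++ nth c (c :: p) j :: drop j p.
  rewrite -{1}(cat_take_drop j.-1 p) (drop_nth c); last by lia.
  by case: (j) lt_ij.
move: chord; set y := nth c _ j in defp *; set p2 := drop j p in defp.
have szp1 : size (take j.-1 p) = j.-1 by rewrite size_take; case: ifP; lia.
set p1 := take j.-1 p in defp szp1; have ip1 : i <= size p1 by rewrite szp1; lia.
rewrite defp -cat_cons nth_cat /= ltnS ip1 -last_take // => chord.
have [cp1 p12 up12] : [/\ path (@sedge F) c p1, path (@sedge F) y p2 & uniq (c :: p1 ++ y :: p2)].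
  by move: up pp; rewrite defp cat_path /= => -> /and3P[].
have cq : graph_path c (take i p1 ++ y :: p2).
  split; first by rewrite cat_path take_path //= chord.
  apply: subseq_uniq up12.
  by rewrite /= eqxx -{2}(cat_take_drop i p1) -catA cat_subseq ?suffix_subseq.
have lq : last c (take i p1 ++ y :: p2) = e by rewrite -lp defp !last_cat.
have := forced_size cp lp cq lq; rewrite defp !size_cat /= size_take szp1.
by case: ifP; lia.
Qed.

(** Two paths that agree so far agree in the next vertex: by inducedness it is one
    of the two path neighbours, and the earlier one has been visited. *)
Lemma forced_only p : graph_path c p -> last c p = e -> only_path c p.
Proof.
move=> cp lp q cq lq; rewrite lp in lq.
have sz := forced_size cq lq cp lp.
have [_ ind] := forced_induced cp lp.
suff eq_nth i : i < size (c :: p) -> nth c (c :: q) i = nth c (c :: p) i.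
  suff: c :: q = c :: p by case.
  by apply: (@eq_from_nth _ c) => [|i] /=; rewrite sz //; apply: eq_nth.
have [qp uq] := cq.
elim/ltn_ind: i => -[|i] IHi ip //.
have : nth c (c :: q) i.+1 \in c :: p.
  by rewrite covers // -(covers cq lq) mem_nth //= sz.
case/(nthP c) => j jp jE; rewrite -jE.
have iq : i < size q by rewrite sz.
have := pathP c qp i iq.
rewrite -[nth c q i]/(nth c (c :: q) i.+1) -jE IHi // 1?ltnW // ind // 1?ltnW //.
case/orP=> /eqP; first by move->.
move=> ij; move: jE; rewrite -(IHi j) //; last by lia.
move/eqP; rewrite nth_uniq //=; lia.
Qed.

End ForcedPaths.

(** * Separation-closed sets *)

(** The trace in one factor of t-convexity in a product: the neighbourhoods that
    walks must avoid shrink to single vertices. *)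
Definition separation_closed (F : sgraph) (A : {set F}) : Prop :=
  forall a1 a2 g, a1 \in A -> a2 \in A -> a1 != a2 ->
    connect (off (pred1 a2)) g a1 -> connect (off (pred1 a1)) g a2 -> g \in A.

(** The two cases are the two orders in which the path can visit [a1] and [a2]. *)
Lemma simple_order (F : sgraph) (c a1 a2 : F) p :
  graph_path c p -> a1 \in c :: p -> a2 \in c :: p -> a1 != a2 ->
  (connect (off (pred1 a2)) a1 c /\ connect (off (pred1 a1)) a2 (last c p)) \/
  (connect (off (pred1 a1)) a2 c /\ connect (off (pred1 a2)) a1 (last c p)).
Proof.
move=> cp pa1 + a12; case/splitPl: pa1 cp => p1 p2 l1 [].
rewrite cat_path last_cat l1 => /andP[cp1 ap2].
rewrite -cat_cons cat_uniq mem_cat => /and3P[up1 disj up2] /orP[p1a|p2a].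
  right; split; last first.
    apply: connect_off ap2 _; apply/allP => z p2z /=.
    by apply: contraNneq disj => zE; apply/hasP; exists z; rewrite // zE.
  apply: off_sym; last by rewrite -l1; apply: simple_head; rewrite // l1 eq_sym.
  case: (p1) l1 up1 p1a => [|z s] /= l1; first by rewrite inE l1 eq_sym (negPf a12).
  by case/andP=> Nc _ _; apply: contraNneq Nc => ->; rewrite -l1 mem_last.
have Na z : z \in c :: p1 -> z != a2.
  by move=> p1z; apply: contraNneq disj => zE; apply/hasP; exists a2; rewrite // -zE.
left; split.
  apply: off_sym; first exact/Na/mem_head.
  rewrite -l1; apply: connect_off cp1 _; apply/allP => z p1z /=.
  by apply: Na; rewrite inE p1z orbT.
apply: simple_tail; last by rewrite inE p2a orbT.
split; rewrite //= up2 andbT; apply: contra disj => p2a1.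
by apply/hasP; exists a1; rewrite // -l1 mem_last.
Qed.

Section SeparationClosed.
Variables (F : sgraph) (A : {set F}).

Lemma inner_neq_ends c (p : seq F) i : uniq (c :: p) -> 0 < i < size p ->
  [/\ nth c (c :: p) i \in c :: p, nth c (c :: p) i != c
    & nth c (c :: p) i != last c p].
Proof.
move=> up /andP[i0 ip]; have ip1 : i < size (c :: p) by rewrite /= ltnS ltnW.
split; first exact: mem_nth.
  by rewrite -[X in _ != X]/(nth c (c :: p) 0) nth_uniq //=; lia.
by rewrite (last_nth c) nth_uniq //=; lia.
Qed.

(** An outside vertex [g] adjacent to an inner vertex reaches either end
    without meeting the other end. *)
Lemma separation_closed_degree2 c p :
  separation_closed A -> A = [set v in c :: p] -> induced_path c p ->
  inner_degree2 c p.
Proof.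
move=> sepA defA [cp ind] i i_in; have [_ up] := cp.
have [vp vc ve] := inner_neq_ends up i_in; set v := nth c _ i in vp vc ve *.
have ce : c != last c p.
  rewrite (last_nth c) -{1}[c]/(nth c (c :: p) 0) nth_uniq //=; lia.
have inA z : (z \in A) = (z \in c :: p) by rewrite defA inE.
have nbh y : v -- y -> y \in c :: p.
  rewrite -inA => vy.
  apply: (sepA c (last c p)); rewrite ?inA ?mem_head ?mem_last //.
    rewrite sedge_sym in vy; apply: connect_trans (off_edge vy ve) _.
    by apply: off_sym (simple_head cp vp ve).
  rewrite sedge_sym in vy; apply: connect_trans (off_edge vy vc) _.
  exact: simple_tail.
pose a := nth c (c :: p) i.-1; pose b := nth c (c :: p) i.+1.
have -> : degree v = #|[set a; b]|; last first.
  by rewrite cards2 /a /b nth_uniq //=; lia.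
apply: eq_card => y; rewrite !inE; apply/idP/orP => [vy | ].
  have /(nthP c)[j jp defy] := nbh y vy.
  move: vy; rewrite -defy ind //=; last by rewrite ltnS; lia.
  by case/orP=> [/eqP-> | /eqP defi]; [right | left; rewrite /a defi].
case=> /eqP->; rewrite ind //=; lia.
Qed.

(** A path from [c] to [e] stays in [A], as its two parts at a vertex [x] screen
    [x] from either end; it visits each separator [a]. *)
Lemma separation_closed_covers c e q :
  separation_closed A -> c \in A -> e \in A -> c != e ->
  (forall a, a \in A -> a != c -> a != e -> ~~ connect (off (pred1 a)) c e) ->
  graph_path c q -> last c q = e -> c :: q =i A.
Proof.
move=> sepA Ac Ae ce sep cq lq x; apply/idP/idP => [qx | Ax].
  have [-> // | xe] := eqVneq x e.
  apply: (sepA c e) => //; last by rewrite -lq; apply: simple_tail.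
  by apply: off_sym => //; rewrite -lq; apply: simple_head; rewrite ?lq.
apply: contraT; rewrite inE negb_or => /andP[xc xq].
have xe : x != e.
  apply: contraNneq xq => ->; have := mem_last c q.
  by rewrite lq inE eq_sym (negPf ce).
case/negP: (sep x Ax xc xe); rewrite -lq; apply: connect_off; first by case: cq.
by apply/allP=> z qz /=; apply: contraNneq xq => <-.
Qed.

(** Through its neighbour [g0], the vertex [c] sees of any two other elements of
    [A] one screened by the other. The last element [e] in this order is found by
    maximizing the set [D e] of vertices that [c] reaches without [e]. *)
Lemma separation_closed_path c g0 a0 :
  connected F -> separation_closed A -> c \in A -> g0 \notin A -> c -- g0 ->
  a0 \in A -> a0 != c ->
  exists p, [/\ induced_path c p, inner_degree2 c p, only_path c p
              & A = [set v in c :: p]].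
Proof.
move=> conF sepA Ac Ng0 cg0 Aa0 a0c.
have total a1 a2 : a1 \in A -> a2 \in A -> a1 != a2 -> a1 != c -> a2 != c ->
    connect (off (pred1 a2)) c a1 -> connect (off (pred1 a1)) c a2 -> False.
  move=> A1 A2 a12 a1c a2c c1 c2; case/negP: Ng0; apply: (sepA a1 a2) => //.
    by apply: connect_trans c1; apply: off_edge; rewrite 1?sedge_sym //= eq_sym.
  by apply: connect_trans c2; apply: off_edge; rewrite 1?sedge_sym //= eq_sym.
pose D a := [set x | connect (off (pred1 a)) c x].
have PA : (a0 \in A) && (a0 != c) by rewrite Aa0.
case: (arg_maxnP (P := [pred a in A | a != c]) (fun a => #|D a|) PA).
move=> e /andP[Ae ec] maxe.
have sep a : a \in A -> a != c -> a != e -> ~~ connect (off (pred1 a)) c e.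
  move=> Aa ac ae; apply/negP=> ce.
  (* Otherwise [e] screens [a], and [D a] properly contains [D e]. *)
  have Nca : ~~ connect (off (pred1 e)) c a.
    by apply/negP=> ca; apply: (total a e).
  have /maxe : (a \in A) && (a != c) by rewrite Aa.
  rewrite /= leqNgt => /negP; apply; apply: proper_card; apply/properP; split.
    by apply/subsetP=> x; rewrite !inE; apply: off_screened.
  exists e; rewrite !inE //; apply/negP => /off_simple[q [_ qe lq]].
  have: e \in c :: q by rewrite -lq mem_last.
  rewrite inE (negPf ec) => /(allP qe).
  by rewrite /= eqxx.
have [p cp lp] := connected_simple c e conF.
have cov q : graph_path c q -> last c q = e -> c :: q =i A.
  by apply: separation_closed_covers; rewrite // eq_sym.
have defA : A = [set v in c :: p].
  by apply/setP=> x; rewrite !in_set; apply/esym/cov.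
have indp := forced_induced cov cp lp.
exists p; split=> //; first exact: separation_closed_degree2.
exact: forced_only cov _ cp lp.
Qed.

(** If [A] were not separation-closed, some [g] off the path would reach each end
    of the path without the other. Its walk to [c] can meet the path only in [c],
    since inner vertices have no further neighbours; but an edge from outside [A]
    to [c] starts a second path from [c] to [e]. *)
Lemma path_separation_closed c p :
  graph_path c p -> inner_degree2 c p -> only_path c p ->
  A = [set v in c :: p] -> separation_closed A.
Proof.
move=> cp deg only defA.
have inA z : (z \in A) = (z \in c :: p) by rewrite defA inE.
set e := last c p in only *.
have sep a : a \in A -> a != c -> ~~ connect (off (pred1 a)) c e.
  rewrite inA inE => /predU1P[-> /eqP // | pa] _.
  apply/negP => /off_simple[q [cq aq /only defq]].
  by move: aq; rewrite defq // => /allP/(_ a pa); rewrite /= eqxx.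
have ends g : g \notin A -> connect (off (pred1 e)) g c ->
    connect (off (pred1 c)) g e -> False.
  move=> Ng gc ge.
  (* [X] cannot be left without meeting [e], so the walk to [c] stays in it. *)
  pose X x := (x \notin A) && connect (off (pred1 c)) x e.
  suff: X c by rewrite /X inA mem_head.
  apply: (connect_invariant (X := X)) gc _; last by rewrite /X Ng.
  move=> x y /andP[Nx xe] /andP[xy /= ye].
  have xc : x != c by apply: contraNneq Nx => ->; rewrite inA mem_head.
  have yc : y != c.
    apply: contraNneq Nx => yc; case: (off_simple xe) => q [[xq uq] Ncq lq].
    have cq : graph_path c (x :: q).
      split; first by rewrite /= sedge_sym -{1}yc xy.
      rewrite cons_uniq uq andbT inE negb_or eq_sym xc.
      by apply/negP=> /(allP Ncq); rewrite /= eqxx.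
    by rewrite inA -(only _ cq lq) !inE eqxx orbT.
  rewrite /X (connect_trans (off_edge (Z := pred1 c) _ xc) xe) 1?sedge_sym // andbT inA.
  apply: contra Nx => /(nthP c)[i ip defy].
  have i_in : 0 < i < size p.
    apply/andP; split; first by case: i defy {ip} yc => //= <-; rewrite eqxx.
    move: ip; rewrite /= ltnS leq_eqVlt => /predU1P[iE|//].
    by move: ye; rewrite -defy iE /e (last_nth c) eqxx.
  have [pp up] := cp; move: (deg i i_in); rewrite /degree defy => deg2.
  pose a := nth c (c :: p) i.-1; pose b := nth c (c :: p) i.+1.
  have sub : [set a; b] \subset [set z | y -- z].
    apply/subsetP=> z; rewrite !inE => /orP[] /eqP->.
      rewrite sedge_sym -defy /a; case: (i) i_in => // j /= jp.
      by apply: (pathP c pp); lia.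
    by rewrite -defy; apply: (pathP c pp); lia.
  have ab : #|[set a; b]| = 2 by rewrite cards2 /a /b nth_uniq //=; lia.
  have /eqP nbh : [set a; b] == [set z | y -- z].
    by rewrite eqEcard sub ab deg2.
  have : x \in [set a; b] by rewrite nbh inE sedge_sym.
  by rewrite !inE => /orP[] /eqP->; rewrite inA mem_nth //=; lia.
move=> a1 a2 g A1 A2 a12 g1 g2; apply: contraT => Ng.
(* With [a1] before [a2] on the path, the screening moves out to the two ends. *)
wlog [a1c a2e] : a1 a2 A1 A2 a12 g1 g2 / connect (off (pred1 a2)) a1 c /\
    connect (off (pred1 a1)) a2 e.
  move=> Wlog; have [] := simple_order cp _ _ a12; rewrite -?inA // => ord.
    exact: (Wlog a1 a2).
  by apply: (Wlog a2 a1); rewrite // eq_sym.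
have a2c : a2 != c by rewrite eq_sym; exact: (off_neq a1c a12).
have ec : e != c by apply: contraNneq (sep _ A2 a2c) => ->.
have ga a : a \in A -> g != a by move=> Aa; apply: contraNneq Ng => ->.
have ne a : a \in A -> ~~ pred1 a g by move=> Aa; apply: ga.
case: (ends g Ng).
  apply: off_sym; first by rewrite /= eq_sym.
  apply: off_screened (sep _ A2 a2c) _; apply: off_sym (ne _ A2) _.
  exact: connect_trans g1 a1c.
have [a1_c|a1_c] := eqVneq a1 c; first by rewrite -a1_c (connect_trans g2).
have a1e : e != a1 by apply: (off_neq a2e); rewrite /= eq_sym.
apply: off_sym => //; apply: (off_screened (a := a1)).
  by apply: contra (sep _ A1 a1_c); apply: off_sym.
by apply: off_sym (ne _ A1) _; apply: connect_trans g2 a2e.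
Qed.

End SeparationClosed.

(** * Convexity in Cartesian products *)

Definition swap (G H : sgraph) (y : cart H G) : cart G H := (y.2, y.1).

Lemma swap_inj (G H : sgraph) : injective (@swap G H).
Proof. by apply: (can_inj (g := @swap H G)); case. Qed.

Lemma swap_edge (G H : sgraph) (x y : cart H G) : (swap x -- swap y) = (x -- y).
Proof. by rewrite /sedge /= /cart_rel /= orbC; congr (_ || _); apply: andbC. Qed.

Lemma t_convex_swap (G H : sgraph) (Y : {set cart G H}) :
  t_convex Y -> t_convex (@swap G H @^-1: Y).
Proof. exact: (t_convex_preim (@swap_inj G H) (@swap_edge G H)). Qed.

Lemma connected_off (F : sgraph) (x y : F) : connected F -> connect (off (pred1 x)) x y.
Proof.
by move=> conF; have [p xp <-] := connected_simple x y conF; apply/simple_tail/mem_head.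
Qed.

Lemma edge_neq (F : sgraph) (x y : F) : x -- y -> x != y.
Proof. by apply: contraTneq => ->; rewrite sedge_irrefl. Qed.

Lemma connected_boundary (F : sgraph) (A : {set F}) a : connected F ->
  a \in A -> A != [set: F] -> exists c g, [/\ c \in A, g \notin A & c -- g].
Proof.
move=> conF Aa AT.
have [/exists_inP[c Ac /existsP[g /andP[cg Ng]]]|noedge] :=
  boolP [exists c in A, exists g, (c -- g) && (g \notin A)]; first by exists c, g.
case/eqP: AT; apply/setP=> z; rewrite inE.
apply: (connect_invariant (X := mem A)) (conF a z) Aa => c g Ac cg.
apply: contraR noedge => Ng; apply/exists_inP; exists c => //.
by apply/existsP; exists g; rewrite cg.
Qed.

Section Product.
Variables G H : sgraph.
Implicit Types (a g : G) (b h : H) (Y : {set cart G H}).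

(** Pairs typed as vertices of the product, so that adjacency is that of [cart]. *)
Definition pt a b : cart G H := (a, b).

Lemma row_edge a a' b : a -- a' -> pt a b -- pt a' b.
Proof. by move=> aa'; rewrite /sedge /= /cart_rel /= aa' eqxx. Qed.

Lemma col_edge a b b' : b -- b' -> pt a b -- pt a b'.
Proof. by move=> bb'; rewrite /sedge /= /cart_rel /= bb' eqxx orbT. Qed.

Lemma cart_closed_nbhd a b a' b' : closed_nbhd (pt a b) (pt a' b') =
  (a == a') && ((b == b') || (b -- b')) || (b == b') && (a -- a').
Proof.
rewrite /closed_nbhd /= {2}/sedge /= /cart_rel /= /pt xpair_eqE.
rewrite (eq_sym a') (eq_sym b').
by case: eqP; case: eqP; rewrite ?andbT ?andbF ?orbF.
Qed.

Lemma cart_nonadj a b a' b' : ~~ closed_nbhd (pt a b) (pt a' b') ->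
  pt a b != pt a' b' /\ ~~ (pt a b -- pt a' b').
Proof. by rewrite /closed_nbhd /= eq_sym negb_or => /andP[]. Qed.

Lemma row_connect (Z : pred G) (Z' : pred (cart G H)) b g a :
  (forall y, ~~ Z y -> ~~ Z' (pt y b)) ->
  connect (off Z) g a -> connect (off Z') (pt g b) (pt a b).
Proof.
move=> ZZ'; apply: (connect_homo (f := fun y => pt y b)) => x y /andP[xy Zy].
by apply: off_edge; [apply: row_edge | apply: ZZ'].
Qed.

Lemma col_connect (Z : pred H) (Z' : pred (cart G H)) a h b :
  (forall y, ~~ Z y -> ~~ Z' (pt a y)) ->
  connect (off Z) h b -> connect (off Z') (pt a h) (pt a b).
Proof.
move=> ZZ'; apply: (connect_homo (f := pt a)) => x y /andP[xy Zy].
by apply: off_edge; [apply: col_edge | apply: ZZ'].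
Qed.

Lemma cart_connectedl b : connected (cart G H) -> connected G.
Proof.
move=> conGH x y; apply: (connect_homo (f := fst)) (conGH (x, b) (y, b)).
move=> p q; rewrite /sedge /= /cart_rel => /orP[/andP[pq _]|/andP[/eqP-> _]] //.
exact: connect1.
Qed.

Lemma off_diag a b a' b' : a != a' -> b != b' -> ~~ closed_nbhd (pt a b) (pt a' b').
Proof. by move=> aa' bb'; rewrite cart_closed_nbhd (negPf aa') (negPf bb'). Qed.

Lemma t_convex_cart Y a b a' b' g h : t_convex Y ->
  pt a b \in Y -> pt a' b' \in Y -> ~~ closed_nbhd (pt a b) (pt a' b') ->
  connect (off (closed_nbhd (pt a' b'))) (pt g h) (pt a b) ->
  connect (off (closed_nbhd (pt a b))) (pt g h) (pt a' b') ->
  pt g h \in Y.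
Proof.
by move=> convY Yu Yv /cart_nonadj[uv Nuv]; apply: (t_convex_off convY Yu Yv uv Nuv).
Qed.

(** With [u = (a, b')] and [v = (a', b)], a simple path in column [a] or in row [b]
    that starts at [(a, b)] does not come back, hence meets only there the
    neighbourhood that it must avoid. *)
Lemma t_convex_corner Y a b a' b' : connected G -> connected H -> t_convex Y ->
  pt a b' \in Y -> pt a' b \in Y -> pt a b \in Y.
Proof.
move=> conG conH convY Yu Yv.
have [-> //|aa'] := eqVneq a a'; have [-> //|bb'] := eqVneq b b'.
apply: (t_convex_cart convY Yu Yv); first by apply: off_diag; rewrite // eq_sym.
  apply: (col_connect (Z := pred1 b)); last exact: connected_off.
  by move=> y /= yb; apply: off_diag; rewrite eq_sym //.
apply: (row_connect (Z := pred1 a)); last exact: connected_off.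
by move=> y /= ya; apply: off_diag; rewrite eq_sym.
Qed.

Lemma t_convex_prod Y : connected G -> connected H -> t_convex Y ->
  Y = setX [set y.1 | y in Y] [set y.2 | y in Y].
Proof.
move=> conG conH convY; apply/setP=> -[a b]; rewrite inE /=.
apply/idP/andP => [Yab | []]; first by split; apply/imsetP; exists (a, b).
case/imsetP=> -[a1 b1] Yu /= -> /imsetP[[a2 b2] Yv /= ->].
exact: t_convex_corner Yu Yv.
Qed.

(** A path between two non-adjacent vertices of row [b], shifted to a
    neighbouring row, becomes a tolled walk between them. *)
Lemma t_convex_col Y a1 a2 b b' : connected G -> t_convex Y ->
  pt a1 b \in Y -> pt a2 b \in Y -> a1 != a2 -> ~~ (a1 -- a2) -> b -- b' ->
  pt a1 b' \in Y.
Proof.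
move=> conG convY Yu Yv a12 Na12 bb'.
have uv : ~~ closed_nbhd (pt a1 b) (pt a2 b).
  by rewrite cart_closed_nbhd (negPf a12) eqxx (negPf Na12).
apply: (t_convex_cart convY Yu Yv uv).
  apply: off_edge; first by rewrite sedge_sym col_edge.
  by rewrite cart_closed_nbhd eq_sym (negPf a12) eqxx sedge_sym (negPf Na12).
apply: (connect_trans (y := pt a2 b')).
  apply: (row_connect (Z := pred1 a1)); last exact: connected_off.
  by move=> y /= ya; apply: off_diag; [rewrite eq_sym | apply: edge_neq].
by apply: off_edge; rewrite // sedge_sym col_edge.
Qed.

(** With [u = (a1, h1)] and [v = (a2, h2)], the walk from [(g, h1)] to [u] runs in
    row [h1], which meets the neighbourhood of [v] only in column [a2]. The other
    walk must first change to row [h2] for the same reason. *)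
Lemma t_convex_separation Y a1 a2 g h1 h2 : t_convex Y ->
  pt a1 h1 \in Y -> pt a2 h2 \in Y -> a1 != a2 -> h1 -- h2 ->
  connect (off (pred1 a2)) g a1 -> connect (off (pred1 a1)) g a2 ->
  pt g h1 \in Y.
Proof.
move=> convY Yu Yv a12 h12 g1 g2; have h12' := edge_neq h12.
have [-> //|ga1] := eqVneq g a1.
apply: (t_convex_cart convY Yu Yv (off_diag a12 h12')).
  apply: row_connect g1 => y /= ya2.
  by apply: off_diag; rewrite eq_sym.
apply: (connect_trans (y := pt g h2)).
  apply: off_edge; first exact: col_edge.
  by apply: off_diag; rewrite // eq_sym.
apply: row_connect g2 => y /= ya1.
by apply: off_diag; rewrite // eq_sym.
Qed.

(** A tolled walk from [(a, b')] to [(a', b)] goes around the corner: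
    [(g, b')], [(g, b)], [(g, h)], [(a, h)], [(a', h)]. *)
Lemma t_convex_outer_corner Y a a' g b b' h : t_convex Y ->
  pt a b' \in Y -> pt a' b \in Y -> a -- a' -> b -- b' ->
  g -- a -> g != a' -> ~~ (g -- a') -> h -- b -> h != b' -> ~~ (h -- b') ->
  pt g h \in Y.
Proof.
move=> convY Yu Yv aa' bb' ga ga' Nga' hb hb' Nhb'.
have [[Eaa' Ebb'] [Ega Ehb]] :=
  ((edge_neq aa', edge_neq bb'), (edge_neq ga, edge_neq hb)).
apply: (t_convex_cart convY Yu Yv); first by apply: off_diag; rewrite // eq_sym.
  apply: (connect_trans (y := pt g b)).
    apply: off_edge; first exact: col_edge.
    by rewrite cart_closed_nbhd eq_sym (negPf ga') sedge_sym (negPf Nga') andbF.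
  apply: (connect_trans (y := pt g b')); apply: off_edge.
  - exact: col_edge.
  - by apply: off_diag; rewrite // eq_sym.
  - exact: row_edge.
  - by apply: off_diag; rewrite // eq_sym.
apply: (connect_trans (y := pt a h)).
  apply: off_edge; first exact: row_edge.
  by rewrite cart_closed_nbhd (eq_sym b') (negPf hb') sedge_sym (negPf Nhb') andbF.
apply: (connect_trans (y := pt a' h)); apply: off_edge.
- exact: row_edge.
- by apply: off_diag; rewrite // eq_sym.
- exact: col_edge.
- by apply: off_diag; rewrite // eq_sym.
Qed.

(** A layer [{a} * H] with [H] complete lies in the closed neighbourhood of
    each of its vertices, so leaving the neighbourhood of [(a, h)] in the
    product projects to leaving [a] in [G]. *)
Lemma separation_closed_t_convex A : complete H -> separation_closed A ->
  t_convex (setX A [set: H] : {set cart G H}).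
Proof.
move=> compH sepA; apply: t_convexP_off => -[a1 h1] [a2 h2] [g h].
rewrite !in_setX !in_setT !andbT /= => A1 A2 uv Nuv _ _ xu xv.
have nbhH a b b' : closed_nbhd (pt a b) (pt a b').
  rewrite cart_closed_nbhd eqxx /=; case: eqVneq => //= bb'.
  by rewrite compH ?inE.
have proj a b x y : connect (off (closed_nbhd (pt a b))) x y ->
    connect (off (pred1 a)) x.1 y.1.
  apply: (connect_homo (f := fst)) => -[x1 x2] [y1 y2] /andP[xy Ny] /=.
  move: xy; rewrite /sedge /= /cart_rel /= => /orP[/andP[xy1 _]|/andP[/eqP-> _]] //.
  by apply: off_edge xy1 _; apply: contraNN Ny => /eqP->; apply: nbhH.
apply: (sepA a1 a2) => //; try exact: proj xu; try exact: proj xv.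
apply: contraNneq uv => a12; move: (nbhH a1 h1 h2) Nuv; rewrite -a12.
by case/orP=> [/eqP E _ | edge /negP[] //]; exact/eqP/esym.
Qed.

End Product.

(** * Convex rectangles *)

(** Like [pt], this fixes the type, so that convexity is that of [cart]. *)
Definition rect (G H : sgraph) (A : {set G}) (B : {set H}) : {set cart G H} := setX A B.

Lemma swap_rect (G H : sgraph) (A : {set G}) (B : {set H}) :
  @swap G H @^-1: rect A B = rect B A.
Proof. by apply/setP=> -[h g]; rewrite !inE andbC. Qed.

Lemma connected_swap (G H : sgraph) : connected (cart G H) -> connected (cart H G).
Proof.
move=> conGH [h g] [h' g'].
apply: (connect_homo (f := @swap H G)) (conGH (g, h) (g', h')) => u v uv.
by apply: connect1; rewrite swap_edge.
Qed.

Section Rectangles.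
Variables (G H : sgraph) (A : {set G}) (B : {set H}).
Hypothesis (convY : t_convex (rect A B)).

Lemma in_rect a b : (pt a b \in rect A B) = (a \in A) && (b \in B).
Proof. by rewrite inE. Qed.

Lemma rect_complete : connected G -> connected H -> B != set0 -> B != [set: H] ->
  induces_complete A.
Proof.
move=> conG conH /set0Pn[b0 Bb0] BT a1 a2 A1 A2 a12; apply: contraT => Na12.
have [d [h [Bd Nh dh]]] := connected_boundary conH Bb0 BT.
suff: pt a1 h \in rect A B by rewrite in_rect (negPf Nh) andbF.
by apply: (t_convex_col (b := d) conG convY _ _ a12 Na12 dh); rewrite in_rect ?A1 ?A2.
Qed.

Lemma rect_separation h1 h2 : h1 \in B -> h2 \in B -> h1 -- h2 -> separation_closed A.
Proof.
move=> B1 B2 h12 a1 a2 g A1 A2 a12 g1 g2.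
suff: pt g h1 \in rect A B by rewrite in_rect => /andP[].
by apply: (t_convex_separation convY _ _ a12 h12 g1 g2); rewrite in_rect ?A1 ?A2.
Qed.

End Rectangles.

Lemma rect_incomplete_swap (G H : sgraph) (A : {set G}) (B : {set H}) :
  ~ induces_complete (rect A B) -> ~ induces_complete (rect B A).
Proof.
move=> Ncomp comp; apply: Ncomp => -[a b] [a' b'] Yu Yv uv.
rewrite -(swap_edge (pt a b) (pt a' b')); apply: comp.
- by move: Yu; rewrite !in_rect andbC.
- by move: Yv; rewrite !in_rect andbC.
by apply: contraNneq uv => -[-> ->].
Qed.

Lemma card_gt1_neq (T : finType) (A : {set T}) c : 1 < #|A| -> exists2 a, a \in A & a != c.
Proof.
case/card_gt1P=> a [b [Aa Ab ab]].
by have [ac|] := eqVneq a c; [exists b; rewrite // -ac eq_sym | exists a].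
Qed.

Lemma separation_closed_outside (F : sgraph) (A : {set F}) a1 a2 g :
  separation_closed A -> a1 \in A -> a2 \in A -> g \notin A -> a1 != a2 ->
  a1 -- g -> ~~ (a2 -- g).
Proof.
move=> sepA A1 A2 Ng a12 g1; apply: contraNN Ng => g2.
by apply: (sepA a1 a2) => //; apply: off_edge; rewrite 1?sedge_sym //= eq_sym.
Qed.

Lemma rect_induces_complete (G H : sgraph) (A : {set G}) (B : {set H}) :
  #|A| <= 1 -> induces_complete B -> induces_complete (rect A B).
Proof.
move=> /card_le1_eqP A1 compB [a b] [a' b']; rewrite !in_rect.
move=> /andP[Aa Bb] /andP[Aa' Bb']; rewrite (A1 _ _ Aa Aa') => ab.
by apply/col_edge/compB => //; apply: contraNneq ab => ->.
Qed.

(** The rectangle lemmas apply to both factors; the choice of the factor that is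
    not everything breaks the symmetry. *)
Lemma t_convex_rect_path (G H : sgraph) (A : {set G}) (B : {set H}) :
  1 < #|H| -> connected (cart G H) -> A != [set: G] ->
  ~ induces_complete (rect A B) -> t_convex (rect A B) ->
  complete H /\ exists (x : G) (p : seq G),
    [/\ induced_path x p, inner_degree2 x p, only_path x p
      & rect A B = setX [set v in x :: p] [set: H]].
Proof.
move=> H1 conGH AT NcompY convY.
have convY' : t_convex (rect B A) by rewrite -swap_rect; apply: t_convex_swap.
have NcompY' := rect_incomplete_swap NcompY.
have [h0 _] : exists h0 : H, h0 \in H by apply/card_gt0P; apply: ltnW.
have conG := cart_connectedl h0 conGH.
have [A0|A0] := eqVneq A set0.
  by case: NcompY => -[a b] v; rewrite in_rect A0 inE.
have /set0Pn[a0 Aa0] := A0.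
have conH := cart_connectedl a0 (connected_swap conGH).
have compB : induces_complete B by apply: rect_complete convY' _ _ _ _.
have A1 : 1 < #|A|.
  rewrite ltnNge; apply/negP=> A1; apply: NcompY.
  exact: rect_induces_complete.
have compA : B != [set: H] -> induces_complete A.
  have [B0|B0] := eqVneq B set0.
    by case: NcompY' => -[b a] v; rewrite in_rect B0 inE.
  exact: rect_complete.
have B1 : 1 < #|B|.
  have [->|BT] := eqVneq B [set: H]; first by rewrite cardsT.
  rewrite ltnNge; apply/negP=> B1; apply: NcompY'.
  exact: rect_induces_complete (compA BT).
have /card_gt1P[h1 [h2 [Bh1 Bh2 h12]]] := B1.
have sepA := rect_separation convY Bh1 Bh2 (compB _ _ Bh1 Bh2 h12).
have [c [g [Ac Ng cg]]] := connected_boundary conG Aa0 AT.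
have [a Aa ac] := card_gt1_neq c A1.
have [BT|BT] := eqVneq B [set: H]; last first.
  have {}compA := compA BT; have aca : c -- a by apply: compA; rewrite // eq_sym.
  have [d [h [Bd Nh dh]]] := connected_boundary conH Bh1 BT.
  have [b Bb bd] := card_gt1_neq d B1.
  have dbd : d -- b by apply: compB; rewrite // eq_sym.
  have sepB := rect_separation convY' Ac Aa aca.
  suff: pt g h \in rect A B by rewrite in_rect (negPf Ng).
  have Nga : ~~ (g -- a).
    by rewrite sedge_sym (separation_closed_outside sepA Ac Aa Ng) // eq_sym.
  have Nhb : ~~ (h -- b).
    by rewrite sedge_sym (separation_closed_outside sepB Bd Bb Nh) // eq_sym.
  apply: (t_convex_outer_corner convY _ _ aca dbd _ _ Nga _ _ Nhb).
  - by rewrite in_rect Ac.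
  - by rewrite in_rect Aa.
  - by rewrite sedge_sym.
  - by apply: contraNneq Ng => ->.
  - by rewrite sedge_sym.
  - by apply: contraNneq Nh => ->.
split; first by rewrite /complete -BT.
have [p [ind deg only defA]] := separation_closed_path conG sepA Ac Ng cg Aa ac.
by exists c, p; split; rewrite // /rect -defA BT.
Qed.

Lemma rect_path_t_convex (G H : sgraph) (x : G) p : complete H ->
  induced_path x p -> inner_degree2 x p -> only_path x p ->
  t_convex (rect [set v in x :: p] [set: H]).
Proof.
move=> compH [xp _] deg only; apply: separation_closed_t_convex => //.
exact: path_separation_closed xp deg only _.
Qed.

Theorem theorem3p2 (G H : sgraph) (Y : {set cart G H}) :
  1 < #|G| -> 1 < #|H| ->
  connected (cart G H) ->
  Y \proper [set: cart G H] ->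
  ~ induces_complete Y ->
  t_convex Y <->
    (complete H /\
     exists (x : G) (p : seq G),
       [/\ induced_path x p, inner_degree2 x p, only_path x p
         & Y = setX [set v in x :: p] [set: H]])
    \/
    (complete G /\
     exists (x : H) (p : seq H),
       [/\ induced_path x p, inner_degree2 x p, only_path x p
         & Y = setX [set: G] [set v in x :: p]]).
Proof.
move=> G1 H1 conGH propY NcompY; split; last first.
  case=> -[comp [x [p [ind deg only ->]]]]; first exact: rect_path_t_convex.
  rewrite -/(rect _ _) -swap_rect; apply: t_convex_swap.
  exact: rect_path_t_convex.
move=> convY.
have [g0 _] : exists g0 : G, g0 \in G by apply/card_gt0P; apply: ltnW.
have [h0 _] : exists h0 : H, h0 \in H by apply/card_gt0P; apply: ltnW.
have conG := cart_connectedl h0 conGH.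
have conH := cart_connectedl g0 (connected_swap conGH).
have := t_convex_prod conG conH convY; rewrite -/(rect _ _).
move: [set y.1 | y in Y] [set y.2 | y in Y] => A B defY.
rewrite {}defY in propY NcompY convY *.
have [AT|AT] := eqVneq A [set: G]; last by left; apply: t_convex_rect_path.
right; have BT : B != [set: H].
  apply: contraTneq propY => BT; rewrite AT BT properE negb_and negbK orbC.
  by apply/orP; left; apply/subsetP => -[a b] _; rewrite !inE.
have convY' : t_convex (rect B A) by rewrite -swap_rect; apply: t_convex_swap.
have NcompY' := rect_incomplete_swap NcompY.
have [compG [x [p [ind deg only defY]]]] :=
  t_convex_rect_path G1 (connected_swap conGH) BT NcompY' convY'.
split=> //; exists x, p; split=> //.
by rewrite -[LHS]swap_rect defY -/(rect _ _) swap_rect.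
Qed.
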